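(* Let $q$ be a prime power, $n\geq 2$, $E=\mathbb{F}_q^n$, and $T=|\mathcal{L}(E)|$. Let $\mathcal{M}=(\mathcal{L}(E),\rho)$ be a $q$-matroid and let $p_{\mathcal{M}}=(\rho(X))_{X\in\mathcal{L}(E)\setminus\{\langle 0\rangle\}}\in\mathbb{R}^{T-1}$ be its corresponding point in the reduced $q$-rank polytope $\bar{\mathcal{P}}_q^n$. Then $p_{\mathcal{M}}$ is a vertex of $\bar{\mathcal{P}}_q^n$.
   Context: $\mathcal{L}(E)$ denotes the lattice of all $\mathbb{F}_q$-subspaces of $E$ ordered by inclusion. A $q$-rank function is a map $\rho:\mathcal{L}(E)\to\mathbb{R}$ with (R1) $0\le\rho(A)\le\dim(A)$, (R2) $A\le B\Rightarrow \rho(A)\le\rho(B)$, (R3) $\rho(A\cap B)+\rho(A+B)\le\rho(A)+\rho(B)$ for all $A,B\in\mathcal{L}(E)$; the pair $(\mathcal{L}(E),\rho)$ is a $q$-polymatroid, and a $q$-matroid if $\rho$ is integer-valued. The $q$-rank polytope $\mathcal{P}_q^n\subseteq\mathbb{R}^{T}$ (coordinates indexed by $\mathcal{L}(E)$) is the set of vectors $v=(v_X)_{X\in\mathcal{L}(E)}$ with $v\ge 0$, $v_X\le\dim X$ for all $X$, $v_X\le v_Y$ whenever $X\le Y$, and $v_{X+Y}+v_{X\cap Y}\le v_X+v_Y$ for all $X,Y$; i.e. the set of image vectors of $q$-rank functions. Since $v_{\langle 0\rangle}=0$ always, the reduced $q$-rank polytope $\bar{\mathcal{P}}_q^n\subseteq\mathbb{R}^{T-1}$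 is the image of $\mathcal{P}_q^n$ under deleting the coordinate indexed by $\langle 0\rangle$. *)

(* Defs.v *)
From HB Require Import structures.
From mathcomp Require Import all_boot all_order all_algebra.
From mathcomp Require Import classical_sets reals.

Set Implicit Arguments.
Unset Strict Implicit.
Unset Printing Implicit Defensive.

Import Order.TTheory GRing.Theory Num.Theory.

Local Open Scope classical_set_scope.
Local Open Scope ring_scope.

Import VectorInternalTheory.

(* Subspaces of a finite-dimensional space over a finite field are a subtype
   of the square matrices over that field, hence form a finite type. *)
HB.instance Definition _ (F : finFieldType) (vT : vectType F) :=
  [Countable of {vspace vT} by <:].
HB.instance Definition _ (F : finFieldType) (vT : vectType F) :=
  [Finite of {vspace vT} by <:].

(* L(E) for E = F^n. *)
Definition subspaces (F : finFieldType) (n : nat) : finType :=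
  {vspace 'rV[F]_n}.

(* L(E) \ {<0>}. *)
Definition nzsubspaces (F : finFieldType) (n : nat) : finType :=
  {X : subspaces F n | X != 0%VS}.

Fact card_nzsubspaces (F : finFieldType) (n : nat) :
  #|nzsubspaces F n| = (#|subspaces F n| - 1)%N.
Proof.
rewrite card_sig subn1 -(cardC1 (0%VS : subspaces F n)).
by apply: eq_card => X; rewrite !inE.
Qed.

Definition q_rank_function (R : realType) (F : finFieldType) (n : nat)
    (rho : subspaces F n -> R) : Prop :=
  [/\ forall A : subspaces F n, 0 <= rho A <= (\dim A)%:R,
      forall A B : subspaces F n, (A <= B)%VS -> rho A <= rho B
    & forall A B : subspaces F n,
        rho (A :&: B)%VS + rho (A + B)%VS <= rho A + rho B].

Definition q_matroid (R : realType) (F : finFieldType) (n : nat)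
    (rho : subspaces F n -> R) : Prop :=
  q_rank_function rho /\ forall A : subspaces F n, rho A \is a Num.int.

Definition q_rank_polytope (R : realType) (F : finFieldType) (n : nat) :
    set {ffun subspaces F n -> R} :=
  [set v | [/\ forall X : subspaces F n, 0 <= v X,
      forall X : subspaces F n, v X <= (\dim X)%:R,
      forall X Y : subspaces F n, (X <= Y)%VS -> v X <= v Y
    & forall X Y : subspaces F n,
        v (X + Y)%VS + v (X :&: Y)%VS <= v X + v Y]].

Definition delete_zero (R : realType) (F : finFieldType) (n : nat)
    (v : {ffun subspaces F n -> R}) : {ffun nzsubspaces F n -> R} :=
  [ffun X => v (val X)].

Definition reduced_q_rank_polytope (R : realType) (F : finFieldType)
    (n : nat) : set {ffun nzsubspaces F n -> R} :=
  @delete_zero R F n @` @q_rank_polytope R F n.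

Definition q_matroid_point (R : realType) (F : finFieldType) (n : nat)
    (rho : subspaces F n -> R) : {ffun nzsubspaces F n -> R} :=
  [ffun X => rho (val X)].

Definition dot (R : realType) (I : finType) (c x : {ffun I -> R}) : R :=
  \sum_(i : I) c i * x i.

(* G is the subset of P where some inequality c.x <= d valid on P is tight. *)
Definition face (R : realType) (I : finType) (P G : set {ffun I -> R}) : Prop :=
  exists (c : {ffun I -> R}) (d : R),
    (forall x, P x -> dot c x <= d) /\ G = P `&` [set x | dot c x = d].

Definition vertex (R : realType) (I : finType) (P : set {ffun I -> R})
    (p : {ffun I -> R}) : Prop :=
  face P [set p].

(* Main.v *)
Require Import Defs.
From HB Require Import structures.
From mathcomp Require Import all_boot all_order all_algebra.
From mathcomp Require Import boolp classical_sets reals.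
From mathcomp Require Import lra.

(** Every subspace [X] contains a subspace [B] with [rho B = dim B] and
    [rho B = rho X], namely a maximal independent one: as [rho] is integral, a
    line that raises the rank of [B] would give a larger independent subspace,
    and by submodularity lines that do not raise it one by one do not raise it
    together.  The inequalities [v B <= dim B] and [v B <= v X] are valid
    on the polytope and tight at [rho], and tightness of both forces
    [v X = rho X].  Hence every coordinate is constant on some face through
    [rho], and the intersection of all these faces is the single point [rho]. *)

Set Implicit Arguments.
Unset Strict Implicit.
Unset Printing Implicit Defensive.

Import Order.TTheory GRing.Theory Num.Theory.
Local Open Scope classical_set_scope.
Local Open Scope ring_scope.

Section Faces.
Context {R : realType} {I : finType}.
Implicit Types (c x p : {ffun I -> R}) (P G H : set {ffun I -> R}).

Lemma dotDl c c' x : dot (c + c') x = dot c x + dot c' x.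
Proof. by rewrite -big_split; apply: eq_bigr => i _; rewrite ffunE mulrDl. Qed.

Lemma dotBl c c' x : dot (c - c') x = dot c x - dot c' x.
Proof. by rewrite -sumrB; apply: eq_bigr => i _; rewrite !ffunE mulrBl. Qed.

Lemma dot0l x : dot 0 x = 0.
Proof. by apply: big1 => i _; rewrite ffunE mul0r. Qed.

Definition coord_functional (i : I) : {ffun I -> R} := [ffun j => (j == i)%:R].

Lemma dot_coord_functional i x : dot (coord_functional i) x = x i.
Proof.
rewrite /dot (bigD1 i) //= ffunE eqxx mul1r big1 ?addr0 // => j /negPf ji.
by rewrite ffunE ji mul0r.
Qed.

Lemma face_refl P : face P P.
Proof.
exists 0, 0; split=> [x _|]; first by rewrite dot0l.
by apply/seteqP; split=> [x Px|x []//]; split=> //=; rewrite dot0l.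
Qed.

(* The sum of two valid inequalities is tight exactly where both are. *)
Lemma faceI P G H : face P G -> face P H -> face P (G `&` H).
Proof.
move=> [c [d [c_le ->]]] [c' [d' [c'_le ->]]]; exists (c + c'), (d + d').
split=> [x Px|]; first by rewrite dotDl lerD ?c_le ?c'_le.
apply/seteqP; split=> x /=.
  by move=> [[Px xd] [_ xd']]; rewrite dotDl xd xd'.
move=> [Px]; rewrite dotDl => tight.
by have := c_le x Px; have := c'_le x Px; split; split=> //; lra.
Qed.

Lemma face_bigcap (J : finType) P (G : J -> set {ffun I -> R}) :
  (forall j, face P (G j)) -> face P (P `&` \bigcap_j G j).
Proof.
move=> faceG; have -> : [set: J] = [set` enum J].
  by apply/seteqP; split=> j //= _; rewrite mem_enum.
rewrite bigcap_seq; elim/big_rec: _ => [|j A _ faceA].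
  by rewrite setIT; apply: face_refl.
by rewrite setICA; apply: faceI.
Qed.

Lemma face_coord_le_cst P i d :
  (forall x, P x -> x i <= d) -> face P (P `&` [set x | x i = d]).
Proof.
move=> le_d; exists (coord_functional i), d.
split=> [x Px|]; first by rewrite dot_coord_functional le_d.
by congr (P `&` _); apply/funext => x /=; rewrite dot_coord_functional.
Qed.

Lemma face_coord_le_coord P i j :
  (forall x, P x -> x i <= x j) -> face P (P `&` [set x | x i = x j]).
Proof.
move=> le_ij; exists (coord_functional i - coord_functional j), 0.
split=> [x Px|]; first by rewrite dotBl !dot_coord_functional subr_le0 le_ij.
congr (P `&` _); apply/funext => x /=; rewrite dotBl !dot_coord_functional.
by apply/propext; split=> [->|/eqP]; rewrite ?subrr // subr_eq0 => /eqP.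
Qed.

Lemma vertex_coordwise P p :
    P p ->
    (forall i, exists G, [/\ face P G, G p & forall x, G x -> x i = p i]) ->
  vertex P p.
Proof.
move=> Pp /choice[G faceG]; rewrite /vertex.
have -> : [set p] = P `&` \bigcap_i G i.
  apply/seteqP; split=> [_ ->|x [_ Gx]].
    by split=> // i _; case: (faceG i).
  by apply/ffunP => i; have [_ _] := faceG i; apply; apply: Gx.
by apply: face_bigcap => i; case: (faceG i).
Qed.

End Faces.

Section QMatroidBases.
Context {R : realType} {F : finFieldType} {n : nat}.
Implicit Types (rho : subspaces F n -> R) (B I X Y Z : subspaces F n).

Lemma q_rank0 rho : q_rank_function rho -> rho 0%VS = 0.
Proof.
by case=> bnd _ _; apply/le_anti; have := bnd 0%VS; rewrite dimv0 andbC.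
Qed.

Lemma q_rank_addv_eq rho I Y Z :
    q_rank_function rho -> (I <= Y)%VS -> rho (I + Z)%VS = rho I ->
  rho (Y + Z)%VS = rho Y.
Proof.
move=> [_ mono submod] IY IZ.
have : rho Y <= rho (Y + Z)%VS by rewrite mono ?addvSl.
have : rho I <= rho ((I + Z) :&: Y)%VS by rewrite mono // subv_cap addvSl.
have := submod (I + Z)%VS Y.
by rewrite IZ -addvA (addvC Z) addvA (addv_idPr IY); lra.
Qed.

Lemma q_rank_add_span_eq rho I (s : seq 'rV[F]_n) :
    q_rank_function rho -> {in s, forall x, rho (I + <[x]>)%VS = rho I} ->
  rho (I + <<s>>)%VS = rho I.
Proof.
move=> rho_rank; elim: s => [|x s IHs] fixI; first by rewrite span_nil addv0.
rewrite span_cons (addvC <[x]>%VS) addvA (q_rank_addv_eq rho_rank (addvSl I _)).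
  by apply: IHs => y ys; rewrite fixI // mem_behead.
by rewrite fixI ?mem_head.
Qed.

Definition independent rho I := rho I == (\dim I)%:R.

Definition q_matroid_basis rho X B :=
  [/\ (B <= X)%VS, independent rho B & rho B = rho X].

Lemma independent_add_line rho I (x : 'rV[F]_n) :
    q_matroid rho -> independent rho I -> rho I < rho (I + <[x]>)%VS ->
  independent rho (I + <[x]>)%VS.
Proof.
move=> [[bnd _ _] rho_int] /eqP->; rewrite /independent.
have /andP[rho_ge0 rho_le] := bnd (I + <[x]>)%VS.
have /natrP[m rhoE] : rho (I + <[x]>)%VS \is a Num.nat.
  by rewrite natrEint rho_int.
move: rho_le; rewrite rhoE ler_nat ltr_nat eqr_nat eqn_leq => -> /=.
apply: leq_trans; rewrite (leq_trans (dimv_add_leqif _ _)) // dim_vline.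
by case: (x != 0); rewrite ?addn0 ?addn1.
Qed.

Lemma exists_q_matroid_basis rho X :
  q_matroid rho -> exists B, q_matroid_basis rho X B.
Proof.
move=> rhoM; have [rho_rank _] := rhoM; have [_ mono _] := rho_rank.
pose indep_in I := (I <= X)%VS && independent rho I.
have indep0 : indep_in 0%VS.
  by rewrite /indep_in sub0v /independent q_rank0 // dimv0 eqxx.
have [B /andP[BX indepB] maxB] := arg_maxnP (fun I => \dim I) indep0.
exists B; split=> //; rewrite -(addv_idPr BX) -(span_basis (vbasisP X)).
rewrite q_rank_add_span_eq // => x /vbasis_mem xX.
apply: contrapT => /eqP rank_neq.
have lt_rank : rho B < rho (B + <[x]>)%VS.
  by rewrite lt_neqAle eq_sym rank_neq mono ?addvSl.
have := maxB (B + <[x]>)%VS.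
rewrite /indep_in subv_add BX -memvE xX independent_add_line //.
move=> /(_ isT) dim_le.
suff BxE : B = (B + <[x]>)%VS by rewrite -BxE ltxx in lt_rank.
by apply/eqP; rewrite eqEdim addvSl.
Qed.

End QMatroidBases.

Section QRankPolytope.
Context {R : realType} {F : finFieldType} {n : nat}.
Implicit Types v c : {ffun subspaces F n -> R}.

Lemma q_rank_polytopeP v : q_rank_polytope v <-> q_rank_function v.
Proof.
split=> [[ge0 le_dim mono submod]|[bnd mono submod]]; split=> //.
- by move=> A; rewrite ge0 le_dim.
- by move=> A B; rewrite addrC.
- by move=> X; have /andP[] := bnd X.
- by move=> X; have /andP[] := bnd X.
- by move=> X Y; rewrite addrC.
Qed.

Lemma vertex_q_rank_polytope v :
  q_matroid v -> vertex (@q_rank_polytope R F n) v.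
Proof.
move=> vM; have /q_rank_polytopeP vP := vM.1.
apply: vertex_coordwise => // X.
have [B [BX /eqP indepB vB]] := exists_q_matroid_basis X vM.
exists ((@q_rank_polytope R F n `&` [set u | u B = (\dim B)%:R]) `&`
        (@q_rank_polytope R F n `&` [set u | u B = u X])); split=> //.
- apply: faceI.
    by apply: face_coord_le_cst => u [].
  by apply: face_coord_le_coord => u [_ _ mono _]; apply: mono.
- by move=> u [[_ /= uB] [_ /= <-]]; rewrite uB -indepB.
Qed.

Lemma dot_delete_zero c v :
  v 0%VS = 0 -> dot (delete_zero c) (delete_zero v) = dot c v.
Proof.
move=> v0; rewrite /dot [RHS](bigD1 (0%VS : subspaces F n)) //= v0 mulr0 add0r.
rewrite (big_sub [pred X : subspaces F n | X != 0%VS]).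
by apply: eq_bigr => X _; rewrite !ffunE.
Qed.

Lemma face_delete_zero (G : set {ffun subspaces F n -> R}) :
    face (@q_rank_polytope R F n) G ->
  face (@reduced_q_rank_polytope R F n) (@delete_zero R F n @` G).
Proof.
have dotE c v :
    q_rank_polytope v -> dot (delete_zero c) (delete_zero v) = dot c v.
  by move=> /q_rank_polytopeP/q_rank0; apply: dot_delete_zero.
move=> [c [d [c_le ->]]]; exists (delete_zero c), d; split.
  by move=> _ [v vP <-]; rewrite dotE // c_le.
apply/seteqP; split=> [_ [v [vP vd] <-]|_ [[v vP <-] vd]].
  by split; [exists v | rewrite /= dotE].
by exists v => //; split=> //=; rewrite -dotE.
Qed.

Lemma vertex_delete_zero v :
    vertex (@q_rank_polytope R F n) v ->
  vertex (@reduced_q_rank_polytope R F n) (delete_zero v).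
Proof. by move/face_delete_zero; rewrite image_set1. Qed.

End QRankPolytope.

Theorem theorem3p8 (R : realType) (F : finFieldType) (n : nat)
    (hn : (2 <= n)%N) (rho : subspaces F n -> R) (hrho : q_matroid rho) :
  vertex (@reduced_q_rank_polytope R F n) (q_matroid_point rho).
Proof.
pose v := [ffun X => rho X] : {ffun subspaces F n -> R}.
have vE : v = rho :> (subspaces F n -> R) by apply/funext => X; rewrite ffunE.
have -> : q_matroid_point rho = delete_zero v.
  by apply/ffunP => X; rewrite !ffunE.
by apply/vertex_delete_zero/vertex_q_rank_polytope; rewrite vE.
Qed.
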